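(* For any integers $m$ and $n$ the variant $\mathscr{C}_{\mathbb{Z}}^{m,n}$ of the extended bicyclic semigroup $\mathscr{C}_{\mathbb{Z}}$ is not finitely generated (as a semigroup).
   Context: The extended bicyclic semigroup $\mathscr{C}_{\mathbb{Z}}$ is the set $\mathbb{Z}\times\mathbb{Z}$ with the associative operation $(a,b)\cdot(c,d)=(a-b+c,d)$ if $b<c$; $(a,d)$ if $b=c$; $(a,d+b-c)$ if $b>c$. For integers $m,n$, the variant $\mathscr{C}_{\mathbb{Z}}^{m,n}$ is the set $\mathbb{Z}\times\mathbb{Z}$ with the semigroup operation $(a,b)\ast_{m,n}(c,d)=(a,b)\cdot(m,n)\cdot(c,d)$. *)

(* Defs.v *)
From HB Require Import structures.
From mathcomp Require Import all_boot all_order all_algebra.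
From mathcomp Require Import zify.

Set Implicit Arguments.
Unset Strict Implicit.
Unset Printing Implicit Defensive.

Import Order.TTheory GRing.Theory Num.Theory.
Local Open Scope ring_scope.

(* An alias of int * int, so that the semigroup law below does not interfere
   with any structure inferred on the product type. *)
Definition ext_bicyclic : Type := (int * int)%type.

HB.instance Definition _ := Choice.on ext_bicyclic.

Definition ext_bicyclic_mul (x y : ext_bicyclic) : ext_bicyclic :=
  let: (a, b) := x in let: (c, d) := y in
  if b < c then (a - b + c, d)
  else if b == c then (a, d)
  else (a, d + b - c).

Lemma ext_bicyclic_mulA : associative ext_bicyclic_mul.
Proof.
move=> [a b] [c d] [e f]; rewrite /ext_bicyclic_mul.
case: (ltgtP b c) => ?; case: (ltgtP d e) => ?;
  repeat case: ltgtP => ?; congr pair; lia.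
Qed.

HB.instance Definition _ := isSemigroup.Build ext_bicyclic ext_bicyclic_mulA.

(* The carrier does not depend on s; the alias carries the sandwich element so
   that the law x * s * y can be inferred from the type. *)
Definition variant (S : semigroupType) (s : S) : Type := S.

Section Variant.
Variables (S : semigroupType) (s : S).

HB.instance Definition _ := Choice.on (variant s).

Definition variant_mul (x y : variant s) : variant s :=
  ((x : S) * s * (y : S))%g.

Lemma variant_mulA : associative variant_mul.
Proof. by move=> x y z; rewrite /variant_mul !mulgA. Qed.

HB.instance Definition _ := isSemigroup.Build (variant s) variant_mulA.

End Variant.

Definition ext_bicyclic_variant (m n : int) : semigroupType :=
  variant ((m, n) : ext_bicyclic).

(* Closure under nonempty products only: no identity element is adjoined. *)
Inductive generated (S : semigroupType) (A : {pred S}) : S -> Prop :=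
| generated_in x of x \in A : generated A x
| generated_mul x y of generated A x & generated A y : generated A (x * y)%g.

Definition finitely_generated (S : semigroupType) : Prop :=
  exists A : seq S, forall x : S, generated [in A] x.

(* Main.v *)
(** Multiplying on the right never decreases the first coordinate of an element
    of the extended bicyclic semigroup, so the first coordinates of a finitely
    generated subsemigroup of a variant are bounded below by the least first
    coordinate of the generators, whereas [int] has no least element. *)

Require Import Defs.
From mathcomp Require Import all_boot all_order all_algebra.
From mathcomp Require Import zify.

Import Order.TTheory GRing.Theory Num.Theory.
Local Open Scope ring_scope.

(** The first coordinate grows by [c - b] when [b < c] and stays [a] in the other two cases. *)
Lemma ext_bicyclic_mul_fst_ge (x y : ext_bicyclic) :
  x.1 <= (ext_bicyclic_mul x y).1.
Proof.
case: x y => [a b] [c d]; rewrite /ext_bicyclic_mul.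
by case: ltgtP => ? /=; lia.
Qed.

Lemma variant_mul_fst_ge (m n : int) (x y : ext_bicyclic_variant m n) :
  x.1 <= (x * y)%g.1.
(* The variant product is [(x * (m, n)) * y]: two right multiplications in a row. *)
Proof. exact: le_trans (ext_bicyclic_mul_fst_ge _ _) (ext_bicyclic_mul_fst_ge _ _). Qed.

Lemma seq_lower_bound (T : eqType) (f : T -> int) (s : seq T) :
  exists k : int, forall x, x \in s -> k <= f x.
Proof.
elim: s => [|y s [k le_k]]; first by exists 0.
exists (Num.min (f y) k) => x; rewrite inE ge_min => /predU1P[-> | /le_k ->].
  by rewrite lexx.
by rewrite orbT.
Qed.

Theorem corollary2p10 :
  forall m n : int, ~ finitely_generated (ext_bicyclic_variant m n).
Proof.
move=> m n [A genA].
have [k le_k] := seq_lower_bound _ (fun x : ext_bicyclic_variant m n => x.1) A.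
have le_gen x : generated [in A] x -> k <= x.1.
  elim=> [y /le_k // | y z _ le_y _ _].
  (* A product inherits the bound from its left factor. *)
  exact: le_trans le_y (variant_mul_fst_ge _ _ _ _).
(* Any element with first coordinate below [k] contradicts the bound; the second coordinate [0] is
   arbitrary. *)
have := le_gen _ (genA ((k - 1, 0) : ext_bicyclic)).
by rewrite /=; lia.
Qed.
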